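(* Let $X$ be a finite rack, let $m=|X/G_X|$ be the number of orbits of the structure group $G_X$ on $X$, and let $N=|G_X^0|$ be the order of the reduced structure group. Then $\dim_{\mathbb Q} H^i(X,\mathbb Q)=m^i$ for all $i\ge 0$. Furthermore, the only primes which can appear in the torsion of $H^\bullet(X,\mathbb Z)$ are those dividing $N$.
   Context: A rack is a set $X$ with a binary operation $\triangleright$ such that $y\mapsto x\triangleright y$ is a bijection of $X$ for every $x\in X$, and $x\triangleright(y\triangleright z)=(x\triangleright y)\triangleright(x\triangleright z)$ for all $x,y,z\in X$. Its structure group $G_X$ is the group generated by the elements of $X$ with relations $xy=(x\triangleright y)x$; it acts on $X$ from the left, the generator $x$ acting by $y\mapsto x\triangleright y$. The reduced structure group $G_X^0$ is the quotient of $G_X$ by the kernel of this action, i.e. the group of permutations of $X$ generated by the maps $x\triangleright -$; it is finite for finite $X$. For an abelian group $A$ (with trivial $G_X$-action), $H^\bullet(X,A)$ is the cohomology of the complex $C^n(X,A)=\mathrm{Fun}(X^n,A)$, $n\ge0$ (functions $X^n\to A$, with $X^0$ a one-point set), with differential $$df(x_1,\ldots,x_{n+1})=\sum_{i=1}^{n+1}(-1)^{i-1}\Big(f(x_1,\ldots,x_{i-1},x_{i+1},\ldots,x_{n+1})-f(x_1,\ldots,x_{i-1},x_i\triangleright x_{i+1},\ldots,x_i\triangleright x_{n+1})\Big).$$ *)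

(* Defs.v *)
From HB Require Import structures.
From mathcomp Require Import all_boot all_order all_fingroup all_algebra.
From mathcomp Require Import generic_quotient ring_quotient boolp.

Set Implicit Arguments.
Unset Strict Implicit.
Unset Printing Implicit Defensive.

Import GRing.Theory.

Reserved Notation "x |> y" (at level 40, left associativity).

HB.mixin Record isRack X := {
  rack_op : X -> X -> X;
  rack_op_bij : forall x, bijective (rack_op x);
  rack_opA : forall x y z,
    rack_op x (rack_op y z) = rack_op (rack_op x y) (rack_op x z)
}.

#[short(type="rackType")]
HB.structure Definition Rack := {X of isRack X & Choice X}.

#[short(type="finRackType")]
HB.structure Definition FinRack := {X of Rack X & Finite X}.

Notation "x |> y" := (rack_op x y).

Section StructureGroup.

Local Open Scope quotient_scope.

Variable X : rackType.
Implicit Types (x y z : X).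

Lemma rack_unop_ex x : exists g, cancel (rack_op x) g /\ cancel g (rack_op x).
Proof. by have [g gK Kg] := rack_op_bij x; exists g. Qed.

(* The inverse of the bijection [rack_op x]. *)
Definition rack_unop x : X -> X := projT1 (cid (rack_unop_ex x)).

Lemma rack_opK x : cancel (rack_op x) (rack_unop x).
Proof. by rewrite /rack_unop; case: cid => g []. Qed.

Lemma rack_unopK x : cancel (rack_unop x) (rack_op x).
Proof. by rewrite /rack_unop; case: cid => g []. Qed.

(* A word in the letters x^{+1} = (true, x) and x^{-1} = (false, x). *)
Definition rack_word := seq (bool * X).
Implicit Types u v w : rack_word.

(* The congruence on words presenting <X | x y = (x |> y) x>. *)
Inductive word_cong : rack_word -> rack_word -> Prop :=
| word_refl w : word_cong w w
| word_sym w1 w2 : word_cong w1 w2 -> word_cong w2 w1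
| word_trans w1 w2 w3 : word_cong w1 w2 -> word_cong w2 w3 -> word_cong w1 w3
| word_cat u1 u2 w1 w2 :
    word_cong u1 u2 -> word_cong w1 w2 -> word_cong (u1 ++ w1) (u2 ++ w2)
| word_inv b x : word_cong [:: (b, x); (~~ b, x)] [::]
| word_rack x y : word_cong [:: (true, x); (true, y)]
                            [:: (true, x |> y); (true, x)].

Definition word_congb u v : bool := `[< word_cong u v >].

Lemma word_congb_equiv : equiv_class_of word_congb.
Proof.
split=> [u|u v|v u w].
- by apply/asboolP; apply: word_refl.
- by apply/asboolP/asboolP; apply: word_sym.
- by move=> /asboolP uv /asboolP vw; apply/asboolP; apply: word_trans uv vw.
Qed.

Canonical word_congb_equiv_rel := EquivRelPack word_congb_equiv.
Canonical word_congb_encModRel := defaultEncModRel word_congb.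

Definition structure_group := {eq_quot word_congb}.
HB.instance Definition _ := EqQuotient.on structure_group.
HB.instance Definition _ := Choice.on structure_group.

Lemma word_congP u v :
  reflect (word_cong u v) (u == v %[mod structure_group]).
Proof. by rewrite piE; apply: asboolP. Qed.

Definition word_oppo w : rack_word := rev [seq (~~ a.1, a.2) | a <- w].

Lemma word_oppoK : involutive word_oppo.
Proof.
move=> w; rewrite /word_oppo map_rev revK -map_comp map_id_in //.
by case=> b x _ /=; rewrite negbK.
Qed.

Lemma word_oppo_cat u v : word_oppo (u ++ v) = word_oppo v ++ word_oppo u.
Proof. by rewrite /word_oppo map_cat rev_cat. Qed.

Lemma word_oppo_r w : word_cong (w ++ word_oppo w) [::].
Proof.
elim: w => [|[b x] w IH]; first exact: word_refl.
have -> : ((b, x) :: w) ++ word_oppo ((b, x) :: w)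
          = [:: (b, x)] ++ ((w ++ word_oppo w) ++ [:: (~~ b, x)]).
  by rewrite -(cat1s _ w) word_oppo_cat !catA.
apply: word_trans (word_inv b x).
rewrite -[[:: _; _]]/([:: (b, x)] ++ ([::] ++ [:: (~~ b, x)])).
by apply: (word_cat (word_refl _)); apply: word_cat IH (word_refl _).
Qed.

Lemma word_oppo_l w : word_cong (word_oppo w ++ w) [::].
Proof. by rewrite -{2}(word_oppoK w); apply: word_oppo_r. Qed.

Lemma word_oppo_cong u v : word_cong u v -> word_cong (word_oppo u) (word_oppo v).
Proof.
move=> uv; have r := word_refl.
apply: (@word_trans _ (word_oppo u ++ (v ++ word_oppo v))).
  rewrite -{1}[word_oppo u]cats0; apply: word_cat => //.
  by apply: word_sym; apply: word_oppo_r.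
rewrite catA -{2}[word_oppo v]cat0s; apply: word_cat => //.
apply: word_trans (word_oppo_l u).
by apply: word_cat => //; apply: word_sym.
Qed.

Definition sg_class w : structure_group := \pi_structure_group w.
Definition sg_one := sg_class [::].
Definition sg_mul (g h : structure_group) := sg_class (repr g ++ repr h).
Definition sg_inv (g : structure_group) := sg_class (word_oppo (repr g)).

Lemma sg_classK g : sg_class (repr g) = g.
Proof. exact: reprK. Qed.

Lemma sg_classP u v : word_cong u v -> sg_class u = sg_class v.
Proof. by move=> uv; apply/eqP/word_congP. Qed.

Lemma word_repr w : word_cong (repr (sg_class w)) w.
Proof. by apply/word_congP/eqP; apply: reprK. Qed.

Lemma sg_mul_pi u v :
  sg_mul (sg_class u) (sg_class v) = sg_class (u ++ v).
Proof. by apply: sg_classP; apply: word_cat; apply: word_repr. Qed.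

Lemma sg_inv_pi u : sg_inv (sg_class u) = sg_class (word_oppo u).
Proof. by apply: sg_classP; apply: word_oppo_cong; apply: word_repr. Qed.

Fact sg_mulA : associative sg_mul.
Proof.
by move=> g h k; rewrite -(sg_classK g) -(sg_classK h) -(sg_classK k) !sg_mul_pi catA.
Qed.

Fact sg_mul1 : left_id sg_one sg_mul.
Proof. by move=> g; rewrite -(sg_classK g) sg_mul_pi. Qed.

Fact sg_mulr1 : right_id sg_one sg_mul.
Proof. by move=> g; rewrite -(sg_classK g) sg_mul_pi cats0. Qed.

Fact sg_mulV : left_inverse sg_one sg_inv sg_mul.
Proof.
move=> g; rewrite -(sg_classK g) sg_inv_pi sg_mul_pi.
by apply/sg_classP/word_oppo_l.
Qed.

Fact sg_mulrV : right_inverse sg_one sg_inv sg_mul.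
Proof.
move=> g; rewrite -(sg_classK g) sg_inv_pi sg_mul_pi.
by apply/sg_classP/word_oppo_r.
Qed.

HB.instance Definition _ := isGroup.Build structure_group
  sg_mulA sg_mul1 sg_mulr1 sg_mulV sg_mulrV.

Definition sg_gen x := sg_class [:: (true, x)].

Definition letter_act (a : bool * X) : X -> X :=
  if a.1 then rack_op a.2 else rack_unop a.2.

Definition word_act w y : X := foldr letter_act y w.

Lemma word_act_cong u v : word_cong u v -> word_act u =1 word_act v.
Proof.
elim=> {u v} //.
- by move=> u v _ IH y; rewrite IH.
- by move=> u v w _ IH1 _ IH2 y; rewrite IH1 IH2.
- by move=> u v w t _ IH1 _ IH2 y; rewrite /word_act !foldr_cat -!/(word_act _ _) IH2 IH1.
- by move=> [] x y /=; rewrite /letter_act /= ?rack_opK ?rack_unopK.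
- by move=> x y z; rewrite /word_act /= /letter_act /= rack_opA.
Qed.

Definition sg_act (g : structure_group) y : X := word_act (repr g) y.

Lemma sg_act_pi w : sg_act (sg_class w) =1 word_act w.
Proof. by move=> y; apply: word_act_cong; apply: word_repr. Qed.

Lemma sg_act_gen x y : sg_act (sg_gen x) y = x |> y.
Proof. by rewrite sg_act_pi. Qed.

Lemma sg_act1 : sg_act 1%g =1 id.
Proof. by move=> y; apply: sg_act_pi. Qed.

Lemma sg_actM g h y : sg_act (g * h)%g y = sg_act g (sg_act h y).
Proof.
by rewrite [(g * h)%g]/(sg_mul g h) sg_act_pi /word_act foldr_cat.
Qed.

End StructureGroup.

Section FiniteRack.

Variable X : finRackType.
Implicit Types x y : X.

Definition rack_orbit x : {set X} :=
  [set y | `[< exists g : structure_group X, y = sg_act g x >]].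

Definition rack_orbits : {set {set X}} := [set rack_orbit x | x : X].

Definition rack_perm x : {perm X} := perm (bij_inj (rack_op_bij x)).

Definition reduced_structure_group : {group {perm X}} :=
  <<[set rack_perm x | x : X]>>%G.

(* This group is indeed the image of the structure group in {perm X}. *)
Lemma reduced_structure_groupP (s : {perm X}) :
  reflect (exists g : structure_group X, s =1 sg_act g)
          (s \in reduced_structure_group).
Proof.
apply: (iffP idP) => [|[g sg]].
  case/gen_prodgP=> n [c cS ->]; elim: n c cS => [|n IH] c cS.
    by exists 1%g => y; rewrite big_ord0 perm1 sg_act1.
  have [|g Hg] := IH (fun i => c (lift ord0 i)); first by move=> i; apply: cS.
  have /imsetP[x _ c0] := cS ord0.
  exists (g * sg_gen x)%g => y.
  by rewrite big_ord_recl permM Hg c0 permE sg_actM sg_act_gen.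
rewrite -(sg_classK g) in sg.
elim: (repr g) s sg => [|a w IH] s sg.
  suff -> : s = 1%g by apply: group1.
  by apply/permP=> y; rewrite sg sg_act_pi perm1.
pose t := rack_perm a.2.
have tS : t \in reduced_structure_group by apply/mem_gen/imset_f.
pose r := (if a.1 then t else t^-1)%g.
have rE : r =1 letter_act a.
  rewrite /letter_act /r; case: a.1 => y; first by rewrite permE.
  by apply: (@perm_inj _ t); rewrite permKV permE rack_unopK.
have rS : r \in reduced_structure_group by rewrite /r; case: a.1; rewrite ?groupV.
rewrite -(groupMr s (groupVr rS)); apply: IH => y.
by apply: (@perm_inj _ r); rewrite permM permKV rE sg !sg_act_pi.
Qed.

Lemma rack_orbitE x :
  rack_orbit x = orbit 'P%act reduced_structure_group x.
Proof.
apply/setP=> y; rewrite inE; apply/asboolP/orbitP => [[g ->]|[s]].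
  have inj : injective (sg_act g).
    apply: (can_inj (g := sg_act g^-1%g)) => z.
    by rewrite -sg_actM mulVg sg_act1.
  exists (perm inj); last by rewrite /= /aperm permE.
  by apply/reduced_structure_groupP; exists g => z; rewrite permE.
by case/reduced_structure_groupP=> g sg <-; exists g; rewrite /= /aperm sg.
Qed.

Lemma rack_orbitsE :
  rack_orbits = orbit 'P%act reduced_structure_group @: [set: X].
Proof.
by apply/setP=> U; apply/imsetP/imsetP => -[x _ ->]; exists x;
   rewrite ?rack_orbitE.
Qed.

End FiniteRack.

Local Open Scope ring_scope.

(* n-cochains X^n -> A, where X^n is the type of maps 'I_n -> X. *)
Notation rack_cochain X n A := {ffun {ffun 'I_n -> X} -> A}.

Section Differential.

Variables (X : finRackType) (n : nat).

(* (x_1, .., x_{i-1}, x_{i+1}, .., x_{n+1}) *)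
Definition face_del (i : 'I_n.+1) (x : {ffun 'I_n.+1 -> X}) :
    {ffun 'I_n -> X} := [ffun j => x (lift i j)].

(* (x_1, .., x_{i-1}, x_i |> x_{i+1}, .., x_i |> x_{n+1}) *)
Definition face_act (i : 'I_n.+1) (x : {ffun 'I_n.+1 -> X}) :
    {ffun 'I_n -> X} :=
  [ffun j => if (lift i j < i)%N then x (lift i j) else x i |> x (lift i j)].

(* The index i is 0-based, hence the sign (-1) ^+ i in place of (-1)^{i-1}. *)
Definition rack_diff (A : zmodType) (f : rack_cochain X n A) :
    rack_cochain X n.+1 A :=
  [ffun x => \sum_(i < n.+1)
     (f (face_del i x) - f (face_act i x)) *~ (-1) ^+ i].

Lemma rack_diff_is_zmod_morphism (A : zmodType) :
  zmod_morphism (@rack_diff A).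
Proof.
move=> f g; apply/ffunP=> x; rewrite !ffunE -sumrB; apply: eq_bigr => i _.
by rewrite !ffunE -mulrzBl opprD addrACA -opprD.
Qed.

HB.instance Definition _ (A : zmodType) :=
  GRing.isZmodMorphism.Build _ _ (@rack_diff A) (@rack_diff_is_zmod_morphism A).

Lemma rack_diffZ (R : nzRingType) (A : lmodType R) :
  scalable (@rack_diff A).
Proof.
move=> a f; apply/ffunP=> x; rewrite !ffunE scaler_sumr; apply: eq_bigr => i _.
by rewrite !ffunE -scalerBr scalerMzr.
Qed.

HB.instance Definition _ (R : nzRingType) (A : lmodType R) :=
  GRing.isScalable.Build R _ _ _ (@rack_diff A) (@rack_diffZ R A).

End Differential.

Section Cocycles.

Variables (X : finRackType) (n : nat).

Definition is_cocycle (A : zmodType) : pred (rack_cochain X n A) :=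
  fun f => rack_diff f == 0.

Lemma is_cocycle_zmod (A : zmodType) : zmod_closed (@is_cocycle A).
Proof.
split=> [|f g /eqP f0 /eqP g0]; first by apply/eqP; rewrite raddf0.
by apply/eqP; rewrite raddfB /= f0 g0 subr0.
Qed.

HB.instance Definition _ (A : zmodType) :=
  GRing.isZmodClosed.Build _ (@is_cocycle A) (@is_cocycle_zmod A).

Lemma is_cocycleZ (R : nzRingType) (A : lmodType R) :
  GRing.scaler_closed (@is_cocycle A).
Proof.
by move=> a f /eqP f0; apply/eqP; rewrite linearZ /= f0 scaler0.
Qed.

HB.instance Definition _ (R : nzRingType) (A : lmodType R) :=
  GRing.isScaleClosed.Build R _ (@is_cocycle A) (@is_cocycleZ R A).

Record rack_cocycle (A : zmodType) := RackCocycle {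
  cocycle_val :> rack_cochain X n A;
  cocycle_valP : cocycle_val \in @is_cocycle A
}.

HB.instance Definition _ A := [isSub for @cocycle_val A].
HB.instance Definition _ A := [Choice of rack_cocycle A by <:].
HB.instance Definition _ A := [SubChoice_isSubZmodule of rack_cocycle A by <:].
HB.instance Definition _ (R : nzRingType) (A : lmodType R) :=
  [SubZmodule_isSubLmodule of rack_cocycle A by <:].

End Cocycles.

(* Coboundaries in degree n; there are no cochains in degree -1. *)
Definition is_coboundary (X : finRackType) (A : zmodType) (n : nat) :
    rack_cochain X n A -> bool :=
  match n with
  | 0 => fun f => f == 0
  | k.+1 => fun f => `[< exists g : rack_cochain X k A, f = rack_diff g >]
  end.

Section Cohomology.

Variables (X : finRackType) (n : nat).

Definition cocycle_coboundary (A : zmodType) : pred (rack_cocycle X n A) :=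
  fun z => is_coboundary (val z).

Lemma is_coboundary_zmod (A : zmodType) : zmod_closed (@is_coboundary X A n).
Proof.
case: n => [|k]; split=> [|f g] /=.
- by rewrite unfold_in /=.
- by rewrite !unfold_in /= => /eqP -> /eqP ->; rewrite subr0.
- by apply/asboolP; exists 0; rewrite raddf0.
move=> /asboolP[f' ->] /asboolP[g' ->].
by apply/asboolP; exists (f' - g'); rewrite raddfB.
Qed.

Lemma cocycle_coboundary_zmod (A : zmodType) :
  zmod_closed (@cocycle_coboundary A).
Proof.
have [B0 BB] := is_coboundary_zmod A.
by split=> [|f g]; rewrite !unfold_in /cocycle_coboundary ?raddfB ?raddf0 //=; apply: BB.
Qed.

HB.instance Definition _ (A : zmodType) :=
  GRing.isZmodClosed.Build _ (@cocycle_coboundary A)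
    (@cocycle_coboundary_zmod A).

Definition coboundaries (A : zmodType) : zmodClosed (rack_cocycle X n A) :=
  GRing.ZmodClosed.clone _ (@cocycle_coboundary A) _.

(* The abelian group H^n(X, A). *)
Definition rack_cohomology (A : zmodType) : Type := Quotient.quot (coboundaries A).

HB.instance Definition _ A := Choice.on (rack_cohomology A).
HB.instance Definition _ A := GRing.Zmodule.on (rack_cohomology A).

Local Open Scope quotient_scope.

Definition coh_class A (z : rack_cocycle X n A) : rack_cohomology A :=
  \pi_(Quotient.quot (coboundaries A)) z.

Definition coh_repr A (c : rack_cohomology A) : rack_cocycle X n A :=
  repr (c : Quotient.quot (coboundaries A)).

Lemma coh_reprK A : cancel (@coh_repr A) (@coh_class A).
Proof. by move=> c; apply: reprK. Qed.

Lemma coh_class_is_zmod_morphism A : zmod_morphism (@coh_class A).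
Proof. exact: pi_is_zmod_morphism. Qed.

HB.instance Definition _ A :=
  GRing.isZmodMorphism.Build _ _ (@coh_class A) (@coh_class_is_zmod_morphism A).

Lemma coh_class_eq0 A (z : rack_cocycle X n A) :
  (coh_class z == 0) = is_coboundary (val z).
Proof.
rewrite -[0 in LHS](raddf0 (@coh_class A)) -[LHS]Quotient.idealrBE subr0.
by [].
Qed.

Section Module.

Variables (R : nzRingType) (A : lmodType R).

Definition coh_scale (a : R) (c : rack_cohomology A) : rack_cohomology A :=
  coh_class (a *: coh_repr c).

Lemma is_coboundaryZ a f :
  is_coboundary f -> is_coboundary (a *: f : rack_cochain X n A).
Proof.
case: n f => [f /eqP ->|k f /asboolP[g ->]] /=; first by rewrite scaler0.
by apply/asboolP; exists (a *: g); rewrite linearZ.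
Qed.

Lemma coh_scale_class a z : coh_scale a (coh_class z) = coh_class (a *: z).
Proof.
apply/eqP; rewrite -subr_eq0 -raddfB -scalerBr coh_class_eq0.
rewrite [val _]linearZ; apply: is_coboundaryZ.
by rewrite -coh_class_eq0 raddfB /= coh_reprK subrr.
Qed.

Fact coh_scaleA a b c : coh_scale a (coh_scale b c) = coh_scale (a * b) c.
Proof. by rewrite -(coh_reprK c) !coh_scale_class scalerA. Qed.

Fact coh_scale1 : left_id 1 coh_scale.
Proof. by move=> c; rewrite -(coh_reprK c) coh_scale_class scale1r. Qed.

Fact coh_scaleDr : right_distributive coh_scale +%R.
Proof.
move=> a c d; rewrite -(coh_reprK c) -(coh_reprK d) -raddfD !coh_scale_class.
by rewrite scalerDr raddfD.
Qed.

Fact coh_scaleDl c : {morph coh_scale^~ c : a b / a + b}.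
Proof.
by move=> a b; rewrite -(coh_reprK c) !coh_scale_class scalerDl raddfD.
Qed.

HB.instance Definition _ := GRing.Zmodule_isLmodule.Build R (rack_cohomology A)
  coh_scaleA coh_scale1 coh_scaleDr coh_scaleDl.

HB.instance Definition _ := GRing.isScalable.Build R _ _ _ (@coh_class A)
  (fun a z => esym (coh_scale_class a z)).

End Module.

End Cohomology.

(* Finite-dimensional cohomology over a field: H^n(X, A) is isomorphic to a
   complement of the coboundaries in the cocycles. *)
Section FiniteDimension.

Variables (X : finRackType) (n : nat) (K : fieldType) (A : vectType K).

Definition cocycle_space : {vspace rack_cochain X n A} :=
  lker (linfun (@rack_diff X n A)).

Definition coboundary_space : {vspace rack_cochain X n A} :=
  match n return {vspace rack_cochain X n A} with
  | 0 => 0%VS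
  | k.+1 => limg (linfun (@rack_diff X k A))
  end.

Lemma mem_cocycle_space f : (f \in cocycle_space) = is_cocycle f.
Proof. by rewrite memv_ker lfunE. Qed.

Lemma mem_coboundary_space f : (f \in coboundary_space) = is_coboundary f.
Proof.
rewrite /coboundary_space; case: n f => [|k] f /=; first by rewrite memv0.
apply/memv_imgP/asboolP => [[g _ ->]|[g ->]].
  by exists g; rewrite lfunE.
by exists g; rewrite ?memvf ?lfunE.
Qed.

Let W := (cocycle_space :\: coboundary_space)%VS.
Let pr := addv_pi1 cocycle_space coboundary_space.

Fact coh_vect_iso : Vector.axiom (\dim W) (rack_cohomology X n A).
Proof.
have prW f : pr f \in W by apply: memv_pi.
have pr_id w : w \in W -> pr w = w.
  by apply: daddv_pi_id; apply: capv_diff.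
have prB f : f \in cocycle_space -> f - pr f \in coboundary_space.
  move=> Zf; rewrite -[f in f - _](@addv_pi1_pi2 _ _ cocycle_space coboundary_space).
    by rewrite addrC addKr memv_pi2.
  by rewrite (subvP (addvSl _ _)).
have prB0 f : f \in coboundary_space -> pr f = 0.
  move=> Bf; have := @addv_pi1_pi2 _ _ cocycle_space coboundary_space f.
  rewrite addv_pi2_id // (subvP (addvSr _ _)) // => /(_ isT).
  by rewrite -[RHS]add0r => /addIr.
have WZ w : w \in W -> w \in @is_cocycle X n A.
  by move=> /(subvP (diffvSl _ _)); rewrite mem_cocycle_space.
pose phi (c : rack_cohomology X n A) : subvs_of W := vsproj W (pr (val (coh_repr c))).
have phiE z : phi (coh_class z) = vsproj W (pr (val z)).
  congr vsproj; apply/eqP; rewrite -subr_eq0 -!raddfB; apply/eqP/prB0.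
  by rewrite mem_coboundary_space -coh_class_eq0 raddfB /= coh_reprK subrr.
have phi_lin : linear phi.
  move=> a c d; rewrite -(coh_reprK c) -(coh_reprK d) -linearP !phiE.
  by rewrite !linearP.
have phi_bij : bijective phi.
  exists (fun w => coh_class (RackCocycle (WZ _ (subvsP w)))) => [c|w].
    rewrite -[RHS]coh_reprK; apply/esym/eqP; rewrite -subr_eq0 -raddfB.
    rewrite coh_class_eq0 raddfB /= vsprojK // -mem_coboundary_space prB //.
    by rewrite mem_cocycle_space; apply: cocycle_valP.
  by rewrite phiE /= pr_id ?subvsP // vsvalK.
have [r r_lin r_bij] := subvs_vect_iso W.
exists (r \o phi); last exact: bij_comp.
by move=> a c d /=; rewrite phi_lin r_lin.
Qed.

HB.instance Definition _ :=
  Lmodule_hasFinDim.Build K (rack_cohomology X n A) coh_vect_iso.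

End FiniteDimension.

(* p is the order of a torsion element of V, or equivalently divides such an
   order: "p appears in the torsion of V". *)
Definition torsion_prime (V : zmodType) (p : nat) : Prop :=
  prime p /\ exists2 v : V, v != 0 & v *+ p = 0.

(* Main.v *)
(* Write N for the order of the reduced structure group G. The homotopy
   f |-> f(x, _) shows that G acts trivially on cohomology, so that up to a
   factor N every cocycle f may be averaged over the diagonal action. The last
   variable y of a cochain never acts, so cochains of degree n + 1 are cochains
   of degree n with coefficients in Fun(X, A). On diagonally invariant cochains
   the differential can be rewritten so that it no longer involves the action on
   these coefficients, and then f(_, z, y) is a homotopy between f(_, y) and
   f(_, z |> y): up to a power of N one may also average over the orbit of y.
   By induction on the degree, a power of N times any cocycle is cohomologous to
   a function of the orbits of its arguments. Such a function is a cocycle, and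
   since summing over G in each variable separately kills coboundaries, it is a
   coboundary only if a power of N annihilates it. *)
Require Import Defs.
From HB Require Import structures.
From mathcomp Require Import all_boot all_order all_fingroup all_algebra.
From mathcomp Require Import boolp.

Set Implicit Arguments.
Unset Strict Implicit.
Unset Printing Implicit Defensive.

Import GRing.Theory Num.Theory.
Local Open Scope ring_scope.

(* A cochain of all degrees at once is a function on [seq X]; [alt F] sums, with
   alternating signs, the values of [F] on all ways to single out an entry. *)
Section AlternatingSum.

Variables (X : Type) (A : zmodType).
Implicit Types (F : seq X -> X -> seq X -> A) (s : seq X).

Fixpoint alt F s : A :=
  if s is x :: s' then F [::] x s' - alt (fun a => F (x :: a)) s' else 0.

Lemma eq_alt F1 F2 s :
  (forall a x b, size (a ++ x :: b) = size s -> F1 a x b = F2 a x b) ->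
  alt F1 s = alt F2 s.
Proof.
elim: s F1 F2 => //= x s IH F1 F2 eqF; rewrite eqF //; congr (_ - _).
by apply: IH => a y b sz; apply: eqF; rewrite /= sz.
Qed.

Lemma alt_eq0 F s :
  (forall a x b, size (a ++ x :: b) = size s -> F a x b = 0) -> alt F s = 0.
Proof.
elim: s F => //= x s IH F F0; rewrite F0 // IH ?subr0 // => a y b sz.
by apply: F0; rewrite /= sz.
Qed.

Lemma alt_sum I (r : seq I) (P : pred I) (F : I -> seq X -> X -> seq X -> A) s :
  alt (fun a x b => \sum_(i <- r | P i) F i a x b) s =
  \sum_(i <- r | P i) alt (F i) s.
Proof.
elim: s F => [|x s IH] F /=; first by rewrite big1_idem //= addr0.
by rewrite IH -sumrB.
Qed.

Lemma altD F1 F2 s :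
  alt (fun a x b => F1 a x b + F2 a x b) s = alt F1 s + alt F2 s.
Proof.
elim: s F1 F2 => [|x s IH] F1 F2 /=; first by rewrite addr0.
by rewrite IH opprD addrACA.
Qed.

Lemma altB F1 F2 s :
  alt (fun a x b => F1 a x b - F2 a x b) s = alt F1 s - alt F2 s.
Proof.
elim: s F1 F2 => [|x s IH] F1 F2 /=; first by rewrite subr0.
by rewrite IH !opprD !opprK addrACA.
Qed.

Lemma altMz F m s : alt (fun a x b => F a x b *~ m) s = alt F s *~ m.
Proof. by elim: s F => [|x s IH] F /=; rewrite ?mul0rz // IH mulrzBl. Qed.

Lemma alt_map (g : X -> X) F s :
  alt F (map g s) = alt (fun a x b => F (map g a) (g x) (map g b)) s.
Proof. by elim: s F => //= x s IH F; rewrite IH. Qed.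

Lemma alt_rcons F s y :
  alt F (rcons s y) =
  alt (fun a x b => F a x (rcons b y)) s + F s y [::] *~ (-1) ^+ size s.
Proof.
elim: s F => [|x s IH] F /=; first by rewrite subr0 add0r.
by rewrite IH exprS mulN1r mulrNz opprD addrA.
Qed.

(** Bridge to the indexed sum in [rack_diff]; [x0] only serves as the default of [nth]. *)
Lemma alt_nth (x0 : X) F s :
  alt F s = \sum_(0 <= i < size s)
    F (take i s) (nth x0 s i) (drop i.+1 s) *~ (-1) ^+ i.
Proof.
elim: s F => [|x s IH] F /=; first by rewrite big_geq.
rewrite big_nat_recl //= drop0 IH -sumrN; congr (_ + _).
by apply: eq_bigr => i _; rewrite /= exprS mulN1r mulrNz.
Qed.

End AlternatingSum.

(** * The reduced structure group acting by rack automorphisms *)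

Section SeqCochains.

Variables (X : finRackType) (A : zmodType).
Implicit Types (f u : seq X -> A) (s t : seq X) (x y : X) (g h : {perm X}).

Local Notation G := (reduced_structure_group X).
Local Notation N := #|G|.

(** The group is finite, so products of generators exhaust it without inverses. Permutations compose
    from left to right: the factor [rack_perm x] acts first. *)
Lemma rsg_ind (P : {perm X} -> Prop) :
  P 1%g -> (forall x g, g \in G -> P g -> P (rack_perm x * g)%g) ->
  forall g, g \in G -> P g.
Proof.
move=> P1 PM _ /gen_prodgP[n [c cS ->]].
suff [] : (\prod_(i < n) c i)%g \in G /\ P (\prod_(i < n) c i)%g by [].
elim: n c cS => [|n IH] c cS; first by rewrite big_ord0 group1.
have [|cG Pc] := IH (fun i => c (lift ord0 i)); first by move=> i; apply: cS.
have /imsetP[x _ c0] := cS ord0.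
rewrite big_ord_recl c0; split; last exact: PM.
by rewrite groupM // mem_gen // imset_f.
Qed.

Lemma rack_perm_rsg x : rack_perm x \in G.
Proof. by rewrite mem_gen ?imset_f. Qed.

Lemma rsg_morph g : g \in G -> {morph g : x y / x |> y}.
Proof.
move: g; apply: rsg_ind => [x y|z g _ gM x y]; first by rewrite !perm1.
by rewrite !permM !permE rack_opA gM.
Qed.

Lemma rsg_unop g x y : g \in G -> g (rack_unop x y) = rack_unop (g x) (g y).
Proof.
move=> Gg; apply: (can_inj (rack_opK (g x))).
by rewrite -rsg_morph // !rack_unopK.
Qed.

Lemma sum_rsgMl (F : {perm X} -> A) h :
  h \in G -> \sum_(g in G) F (h * g)%g = \sum_(g in G) F g.
Proof.
move=> Gh; rewrite [RHS](reindex_inj (mulgI h)) /=.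
by apply: eq_bigl => g; rewrite groupMl.
Qed.

Lemma sum_rsgMr (F : {perm X} -> A) h :
  h \in G -> \sum_(g in G) F (g * h)%g = \sum_(g in G) F g.
Proof.
move=> Gh; rewrite [RHS](reindex_inj (mulIg h)) /=.
by apply: eq_bigl => g; rewrite groupMr.
Qed.

(** * The differential on functions of sequences *)

Definition sdiff f s : A :=
  alt (fun a x b => f (a ++ b) - f (a ++ map (rack_op x) b)) s.

(* On functions invariant under the diagonal action of [G], the action of
   [x_i] on the entries after it may be traded for the inverse action on the
   entries before it. *)
Definition sdiff_inv f s : A :=
  alt (fun a x b => f (a ++ b) - f (map (rack_unop x) a ++ b)) s.

Definition seq_invariant f := forall x s, f (map (rack_op x) s) = f s.

Lemma seq_invariantP f g s : seq_invariant f -> g \in G -> f (map g s) = f s.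
Proof.
move=> f_inv Gg; elim/rsg_ind: g / Gg s => [|x g _ IH] s.
  by rewrite (eq_map (@perm1 _)) map_id.
rewrite -[RHS](f_inv x) -[RHS]IH -map_comp; congr f.
by apply: eq_map => y; rewrite /= permM permE.
Qed.

Lemma sdiff_invE f s : seq_invariant f -> sdiff f s = sdiff_inv f s.
Proof.
move=> f_inv; apply: eq_alt => a x b _; congr (_ - _).
rewrite -[RHS](f_inv x) map_cat -map_comp; congr (f (_ ++ _)).
by rewrite -[LHS]map_id; apply: eq_map => y /=; rewrite rack_unopK.
Qed.

Lemma eq_sdiff f1 f2 s : f1 =1 f2 -> sdiff f1 s = sdiff f2 s.
Proof. by move=> e; apply: eq_alt => a x b _; rewrite !e. Qed.

Lemma sdiff_sum I (r : seq I) (P : pred I) (f : I -> seq X -> A) s :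
  sdiff (fun t => \sum_(i <- r | P i) f i t) s =
  \sum_(i <- r | P i) sdiff (f i) s.
Proof. by rewrite -alt_sum; apply: eq_alt => a x b _; rewrite sumrB. Qed.

Lemma sdiff_inv_sum I (r : seq I) (P : pred I) (f : I -> seq X -> A) s :
  sdiff_inv (fun t => \sum_(i <- r | P i) f i t) s =
  \sum_(i <- r | P i) sdiff_inv (f i) s.
Proof. by rewrite -alt_sum; apply: eq_alt => a x b _; rewrite sumrB. Qed.

Lemma sdiffB f1 f2 s :
  sdiff (fun t => f1 t - f2 t) s = sdiff f1 s - sdiff f2 s.
Proof.
by rewrite -altB; apply: eq_alt => a x b _; rewrite !opprD !opprK addrACA.
Qed.

Lemma sdiffD f1 f2 s :
  sdiff (fun t => f1 t + f2 t) s = sdiff f1 s + sdiff f2 s.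
Proof. by rewrite -altD; apply: eq_alt => a x b _; rewrite opprD addrACA. Qed.

Lemma sdiff_invD f1 f2 s :
  sdiff_inv (fun t => f1 t + f2 t) s = sdiff_inv f1 s + sdiff_inv f2 s.
Proof. by rewrite -altD; apply: eq_alt => a x b _; rewrite opprD addrACA. Qed.

Lemma sdiffMn f k s : sdiff (fun t => f t *+ k) s = sdiff f s *+ k.
Proof. by rewrite pmulrn -altMz; apply: eq_alt => a x b _; rewrite mulrzBl. Qed.

(** Each face shortens its argument by one entry, so the twist by the sign of the length
    anticommutes with the differential. *)
Lemma sdiff_inv_sign f s :
  sdiff_inv (fun t => f t *~ (-1) ^+ size t) s =
  - (sdiff_inv f s *~ (-1) ^+ size s).
Proof.
rewrite -mulrNz -altMz; apply: eq_alt => a x b <-.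
by rewrite !size_cat size_map /= addnS exprS mulN1r opprK mulrzBl.
Qed.

Lemma sdiff_cons f x s :
  sdiff f (x :: s) =
  f s - f (map (rack_op x) s) - sdiff (fun t => f (x :: t)) s.
Proof. by []. Qed.

Lemma sdiff_map g f s :
  g \in G -> sdiff f (map g s) = sdiff (fun t => f (map g t)) s.
Proof.
move=> Gg; rewrite /sdiff alt_map; apply: eq_alt => a x b _.
rewrite !map_cat -!map_comp; congr (_ - f (_ ++ _)).
by apply: eq_map => y /=; rewrite rsg_morph.
Qed.

Lemma sdiff_inv_map g f s :
  g \in G -> sdiff_inv f (map g s) = sdiff_inv (fun t => f (map g t)) s.
Proof.
move=> Gg; rewrite /sdiff_inv alt_map; apply: eq_alt => a x b _.
rewrite !map_cat -!map_comp; congr (_ - f (_ ++ _)).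
by apply: eq_map => y /=; rewrite rsg_unop.
Qed.

(** No earlier entry acts on [y], which can thus be frozen as a parameter; only the face singling
    out [y] adds a correction. *)
Lemma sdiff_inv_rcons f s y :
  sdiff_inv f (rcons s y) =
  sdiff_inv (fun t => f (rcons t y)) s
  + (f s - f (map (rack_unop y) s)) *~ (-1) ^+ size s.
Proof.
rewrite /sdiff_inv alt_rcons !cats0; congr (_ + _).
by apply: eq_alt => a x b _; rewrite -!rcons_cat.
Qed.

Lemma sdiff_rcons f s y :
  (forall x t, f (rcons t (x |> y)) = f (rcons t y)) ->
  sdiff f (rcons s y) = sdiff (fun t => f (rcons t y)) s.
Proof.
move=> fy; rewrite /sdiff alt_rcons !cats0 subrr mul0rz addr0.
by apply: eq_alt => a x b _; rewrite map_rcons -!rcons_cat fy.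
Qed.

(** * Averaging over the diagonal action *)

(** The sum stays undivided because [A] is an arbitrary abelian group; hence the powers of [N]
    below. *)
Definition diag_avg f s : A := \sum_(g in G) f (map g s).

Lemma diag_avg_invariant f : seq_invariant (diag_avg f).
Proof.
move=> x s; rewrite /diag_avg.
rewrite -(sum_rsgMl (fun g => f (map g s)) (rack_perm_rsg x)).
apply: eq_bigr => g _; rewrite -map_comp; congr f.
by apply: eq_map => y /=; rewrite permM permE.
Qed.

Lemma sdiff_diag_avg f s :
  sdiff (diag_avg f) s = \sum_(g in G) sdiff f (map g s).
Proof. by rewrite sdiff_sum; apply: eq_bigr => g Gg; rewrite sdiff_map. Qed.

(* The homotopy [f |-> f (x, _)] shows that [x] acts trivially on cohomology. *)
Lemma cocycle_act f g :
  (forall s, sdiff f s = 0) -> g \in G ->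
  exists u, forall s, f s - f (map g s) = sdiff u s.
Proof.
move=> df0 Gg; elim/rsg_ind: g / Gg => [|x g Gg [u Hu]].
  exists (fun=> 0) => s; rewrite (eq_map (@perm1 _)) map_id subrr.
  by rewrite /sdiff alt_eq0 // => *; rewrite subrr.
exists (fun t => f (x :: t) + u (map (rack_perm x) t)) => s.
rewrite sdiffD -sdiff_map ?rack_perm_rsg // -Hu.
have /eqP := df0 (x :: s); rewrite sdiff_cons subr_eq0 => /eqP <-.
rewrite (eq_map (permE (f:=rack_op x) (bij_inj (rack_op_bij x)))) addrA subrK.
by rewrite -map_comp; congr (_ - f _); apply: eq_map => y; rewrite permM permE.
Qed.

Lemma cocycle_diag_avg f :
  (forall s, sdiff f s = 0) ->
  exists u, forall s, f s *+ N - diag_avg f s = sdiff u s.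
Proof.
move=> df0.
have /choice[u Hu] : forall g, exists u, forall s,
    g \in G -> f s - f (map g s) = sdiff u s.
  move=> g; case Gg: (g \in G); last by exists f.
  by have [u Hu] := cocycle_act df0 Gg; exists u.
exists (fun s => \sum_(g in G) u g s) => s.
rewrite sdiff_sum -sumr_const -sumrB; apply: eq_bigr => g Gg.
by rewrite Hu.
Qed.

(** * Averaging over the orbit of the last variable *)

Definition on_rcons (F : seq X -> X -> A) s : A :=
  if s is x :: s' then F (belast x s') (last x s') else 0.

Lemma on_rconsE F s y : on_rcons F (rcons s y) = F s y.
Proof. by case: s => //= x s; rewrite belast_rcons last_rcons. Qed.

Definition last_avg f : seq X -> A :=
  on_rcons (fun s y => \sum_(g in G) f (rcons s (g y))).

Lemma last_avg_rcons f s y :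
  last_avg f (rcons s y) = \sum_(g in G) f (rcons s (g y)).
Proof. exact: on_rconsE. Qed.

Lemma last_avg_op f s x y :
  last_avg f (rcons s (x |> y)) = last_avg f (rcons s y).
Proof.
rewrite !last_avg_rcons.
rewrite -(sum_rsgMl (fun g => f (rcons s (g y))) (rack_perm_rsg x)).
by apply: eq_bigr => g _; rewrite permM permE.
Qed.

(** The twist of the last entry by an earlier entry [x] is absorbed by reindexing [g] as
    [g * rack_perm x]. *)
Lemma sdiff_last_avg f s y :
  sdiff (last_avg f) (rcons s y) = \sum_(g in G) sdiff f (rcons s (g y)).
Proof.
rewrite sdiff_rcons => [|x t]; last exact: last_avg_op.
rewrite /sdiff.
under [RHS]eq_bigr do rewrite alt_rcons !cats0 subrr mul0rz addr0.
rewrite -alt_sum; apply: eq_alt => a x b _; rewrite !last_avg_rcons sumrB.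
congr (_ - _); first by apply: eq_bigr => g _; rewrite rcons_cat.
rewrite -[LHS](sum_rsgMr _ (rack_perm_rsg x)); apply: eq_bigr => g _.
by rewrite map_rcons -rcons_cat permM permE.
Qed.

(* No entry of [sdiff_inv f] acts on the last one, so on an invariant cocycle
   [f] it exhibits [f (_, z, y)] as a homotopy between [f (_, y)] and
   [f (_, z |> y)]. *)
Lemma invariant_cocycle_last_act f g :
  seq_invariant f -> (forall s, sdiff f s = 0) -> g \in G ->
  exists u : X -> seq X -> A, forall s y,
    f (rcons s y) - f (rcons s (g y)) = sdiff_inv (u y) s.
Proof.
move=> f_inv df0 Gg; elim/rsg_ind: g / Gg => [|x g Gg [u Hu]].
  exists (fun=> fun=> 0) => s y; rewrite perm1 subrr.
  by rewrite /sdiff_inv alt_eq0 // => *; rewrite subrr.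
(* The permutation [rack_perm x * g] first carries [y] to [x |> y], then applies [g]. The first
   summand handles the first move, and the inductive homotopy taken at [x |> y] handles the
   second. *)
exists (fun y t =>
  f (rcons (rcons t x) y) *~ (-1) ^+ size t + u (x |> y) t) => s y.
rewrite sdiff_invD sdiff_inv_sign -Hu permM permE addrA; congr (_ - _).
(* The cocycle equation at (s, x, y) is peeled from the right: invariance kills the face of [y], and
   the face of [x] leaves f(s, y) - f(s, x |> y) up to sign. *)
have /eqP := df0 (rcons (rcons s x) y); rewrite sdiff_invE // sdiff_inv_rcons.
have -> : f (map (rack_unop y) (rcons s x)) = f (rcons s x).
  rewrite -[LHS](f_inv y) -map_comp -[in RHS](map_id (rcons s x)); congr f.
  by apply: eq_map => z /=; rewrite rack_unopK.
rewrite subrr mul0rz addr0 sdiff_inv_rcons addr_eq0 => /eqP ->.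
rewrite mulNrz -mulrzA -exprD addnn -signr_odd odd_double opprK mulr1z.
have -> : f (rcons (map (rack_unop x) s) y) = f (rcons s (x |> y)).
  rewrite -[LHS](f_inv x) map_rcons -map_comp; congr (f (rcons _ _)).
  by rewrite -[RHS]map_id; apply: eq_map => z /=; rewrite rack_unopK.
by rewrite subrK.
Qed.

Lemma last_avg_invariant f : seq_invariant f -> seq_invariant (last_avg f).
Proof.
move=> f_inv x; elim/last_ind => // s y _.
rewrite map_rcons last_avg_op !last_avg_rcons.
rewrite -[LHS](sum_rsgMr _ (rack_perm_rsg x)); apply: eq_bigr => g _.
by rewrite permM permE -[RHS](f_inv x) map_rcons.
Qed.

Lemma invariant_cocycle_last_avg f :
  seq_invariant f -> (forall s, sdiff f s = 0) ->
  exists u, forall s y,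
    (f (rcons s y) *+ N - last_avg f (rcons s y)) *+ N = sdiff u (rcons s y).
Proof.
move=> f_inv df0.
have /choice[u Hu] : forall g, exists u : X -> seq X -> A, forall s y,
    g \in G -> f (rcons s y) - f (rcons s (g y)) = sdiff_inv (u y) s.
  move=> g; case Gg: (g \in G); last by exists (fun=> f).
  by have [u Hu] := invariant_cocycle_last_act f_inv df0 Gg; exists u.
pose v y s := \sum_(g in G) u g y s.
have Hv s y : f (rcons s y) *+ N - last_avg f (rcons s y) = sdiff_inv (v y) s.
  rewrite sdiff_inv_sum last_avg_rcons -sumr_const -sumrB.
  by apply: eq_bigr => g Gg; rewrite Hu.
(* The assembled homotopy need not be invariant, yet [sdiff_inv] replaces [sdiff] only on invariant
   functions. Averaging restores invariance at the cost of a second factor [N]. *)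
pose w := diag_avg (on_rcons (fun s y => v y s)).
have w_inv : seq_invariant w by apply: diag_avg_invariant.
exists w => s y; rewrite sdiff_invE // sdiff_inv_rcons.
have -> : w (map (rack_unop y) s) = w s.
  rewrite -[LHS](w_inv y) -map_comp -[in RHS](map_id s); congr w.
  by apply: eq_map => z /=; rewrite rack_unopK.
rewrite subrr mul0rz addr0 sdiff_inv_sum -sumr_const; apply: eq_bigr => g Gg.
transitivity (sdiff_inv (v (g y)) (map g s)).
  rewrite -Hv -map_rcons !(seq_invariantP _ _ Gg) //.
  exact: last_avg_invariant.
rewrite sdiff_inv_map //; apply: eq_alt => a x b _.
by rewrite !map_rcons !on_rconsE.
Qed.

(** For a fixed diagonal [g], the last entry is moved by [g * h] on one side and by [h * g] on the
    other; both products exhaust [G]. *)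
Lemma diag_last_avg f s : diag_avg (last_avg f) s = last_avg (diag_avg f) s.
Proof.
case/lastP: s => [|s y].
  by rewrite /diag_avg big1 // => g _.
rewrite last_avg_rcons exchange_big; apply: eq_bigr => g Gg.
rewrite map_rcons last_avg_rcons.
pose F k := f (rcons (map g s) (aperm y k)).
transitivity (\sum_(k in G) F k).
  by rewrite -(sum_rsgMl F Gg); apply: eq_bigr => h _; rewrite /F /aperm permM.
rewrite -(sum_rsgMr F Gg); apply: eq_bigr => h _.
by rewrite /F /aperm permM map_rcons.
Qed.

(** With P the diagonal and Q the last average, f is compared with Pf, then Pf with QPf = PQf, then
    PQf with Qf. The weights N^2, 1 and N in the witness make the intermediate terms cancel. *)
Lemma cocycle_last_avg f :
  (forall s, sdiff f s = 0) ->
  exists u, forall s y,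
    f (rcons s y) *+ N ^ 3 - last_avg f (rcons s y) *+ N ^ 2 =
    sdiff u (rcons s y).
Proof.
move=> df0; have [u Hu] := cocycle_diag_avg df0.
have dPf0 s : sdiff (diag_avg f) s = 0.
  by rewrite sdiff_diag_avg big1.
have [v Hv] := invariant_cocycle_last_avg (diag_avg_invariant f) dPf0.
have dQf0 s : sdiff (last_avg f) s = 0.
  by case/lastP: s => // s y; rewrite sdiff_last_avg big1.
have [w Hw] := cocycle_diag_avg dQf0.
exists (fun s => u s *+ N ^ 2 + v s - w s *+ N) => s y.
rewrite sdiffB sdiffD !sdiffMn -Hu -Hv -Hw diag_last_avg.
set a := f _; set b := diag_avg f _; set c := last_avg (diag_avg f) _.
set d := last_avg f _.
rewrite !mulrnBl -!mulrnA -expnS mulnn opprB !addrA.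
by rewrite (subrK (b *+ N ^ 2)) (subrK (c *+ N)).
Qed.

(** * Functions of the orbits of the arguments *)

Lemma rack_orbit_rsg g y : g \in G -> rack_orbit (g y) = rack_orbit y.
Proof.
by move=> Gg; rewrite !rack_orbitE; apply: orbit_act.
Qed.

Lemma rack_orbit_op x y : rack_orbit (x |> y) = rack_orbit y.
Proof. by rewrite -(rack_orbit_rsg y (rack_perm_rsg x)) permE. Qed.

(** [pick] sees only the orbit as a set, so all points of an orbit share a representative; the
    default is never reached, as orbits are nonempty. *)
Definition rack_orbit_repr y := odflt y [pick z in rack_orbit y].

Lemma rack_orbit_reprE y :
  exists2 g, g \in G & rack_orbit_repr y = g y.
Proof.
rewrite /rack_orbit_repr; case: pickP => [z|/(_ y)].
  by rewrite rack_orbitE => /orbitP[g Gg <-]; exists g.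
by rewrite rack_orbitE orbit_refl.
Qed.

Lemma eq_rack_orbit_repr y z :
  rack_orbit y = rack_orbit z -> rack_orbit_repr y = rack_orbit_repr z.
Proof.
move=> yz; rewrite /rack_orbit_repr yz; case: pickP => //= /(_ z).
by rewrite rack_orbitE orbit_refl.
Qed.

Definition seq_orbital f :=
  forall s t, map (@rack_orbit X) s = map (@rack_orbit X) t -> f s = f t.

Fixpoint total_avg f s : A :=
  if s is x :: s' then \sum_(g in G) total_avg (fun t => f (g x :: t)) s'
  else f [::].

Lemma eq_total_avg f1 f2 s :
  (forall t, size t = size s -> f1 t = f2 t) -> total_avg f1 s = total_avg f2 s.
Proof.
elim: s f1 f2 => [|x s IH] f1 f2 ef /=; first exact: ef.
by apply: eq_bigr => g _; apply: IH => t st; apply: ef; rewrite /= st.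
Qed.

Lemma total_avgB f1 f2 s :
  total_avg (fun t => f1 t - f2 t) s = total_avg f1 s - total_avg f2 s.
Proof.
by elim: s f1 f2 => //= x s IH f1 f2; rewrite -sumrB; apply: eq_bigr => g _.
Qed.

Lemma total_avg_op f x s :
  total_avg (fun t => f (map (rack_op x) t)) s = total_avg f s.
Proof.
elim: s f => //= y s IH f.
rewrite -[RHS](sum_rsgMr _ (rack_perm_rsg x)); apply: eq_bigr => g _.
by rewrite permM permE -[RHS]IH.
Qed.

(** The action of an entry on the later ones is absorbed by the independent sums over [G] there, so
    the two terms of each face have equal averages. *)
Lemma total_avg_sdiff f s : total_avg (sdiff f) s = 0.
Proof.
elim: s f => //= x s IH f; apply: big1 => g _.
rewrite (total_avgB (fun t => f t - f (map (rack_op (g x)) t))).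
by rewrite total_avgB total_avg_op subrr (IH (fun t => f (g x :: t))) subrr.
Qed.

Lemma total_avg_orbital f s :
  seq_orbital f -> total_avg f s = f s *+ N ^ size s.
Proof.
elim: s f => [|x s IH] f f_orb //=.
rewrite expnSr mulrnA -sumr_const; apply: eq_bigr => g Gg.
rewrite IH => [|t t' tt']; last by apply: f_orb; rewrite /= tt'.
by congr (_ *+ _); apply: f_orb; rewrite /= rack_orbit_rsg.
Qed.

Lemma orbital_coboundary f u n :
  seq_orbital f -> (forall s, size s = n -> f s = sdiff u s) ->
  forall s, size s = n -> f s *+ N ^ n = 0.
Proof.
move=> f_orb fu s sn; rewrite -sn -total_avg_orbital //.
rewrite -[RHS](total_avg_sdiff u s); apply: eq_total_avg => t ts.
by rewrite fu // ts.
Qed.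

(** Freezing the last entry of the last average yields a cocycle to which induction applies;
    comparing [f] with that average costs a factor [N ^ 3] per degree. *)
Lemma cocycle_orbital n f :
  (forall s, sdiff f s = 0) ->
  exists2 phi, seq_orbital phi &
  exists u, forall s, size s = n -> f s *+ N ^ (3 * n) = phi s + sdiff u s.
Proof.
elim: n f => [|n IH] f df0.
  exists (fun=> f [::]) => //; exists f => s /size0nil ->.
  by rewrite muln0 expn0 mulr1n /sdiff /= addr0.
pose q y s := \sum_(g in G) f (rcons s (g y)).
have dq0 y s : sdiff (q y) s = 0.
  transitivity (sdiff (last_avg f) (rcons s y)).
    rewrite sdiff_rcons => [|*]; last exact: last_avg_op.
    by apply: eq_sdiff => t; rewrite last_avg_rcons.
  by rewrite sdiff_last_avg big1.
have /choice[h Hh] : forall y, exists p : (seq X -> A) * (seq X -> A),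
    seq_orbital p.1 /\
    forall s, size s = n -> q y s *+ N ^ (3 * n) = p.1 s + sdiff p.2 s.
  by move=> y; have [phi ? [u ?]] := IH _ (dq0 y); exists (phi, u).
have [v Hv] := cocycle_last_avg df0.
(* Data chosen for each [y] could vary within an orbit. Taken at the representative, they make [phi]
   orbital and [u] blind to the action on its last entry. *)
pose phi := on_rcons (fun s y => (h (rack_orbit_repr y)).1 s).
pose u := on_rcons (fun s y => (h (rack_orbit_repr y)).2 s).
exists (fun s => phi s *+ N ^ 2) => [s t|].
  case/lastP: s => [|s y]; case/lastP: t => [|t z] //.
  - by move=> /(congr1 size); rewrite !size_map size_rcons.
  - by move=> /(congr1 size); rewrite !size_map size_rcons.
  rewrite !map_rcons => /rcons_inj[st /eq_rack_orbit_repr yz].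
  by rewrite /phi !on_rconsE yz; congr (_ *+ _); apply: (Hh _).1.
exists (fun s => v s *+ N ^ (3 * n) + u s *+ N ^ 2) => s.
case/lastP: s => // s y; rewrite size_rcons => -[sn].
rewrite sdiffD !sdiffMn -Hv mulrnBl -!mulrnA -expnD mulnS.
rewrite sdiff_rcons => [|x t]; last first.
  by rewrite /u !on_rconsE (eq_rack_orbit_repr (rack_orbit_op x y)).
rewrite addrCA -mulrnDl.
suff -> : phi (rcons s y) + sdiff (fun t => u (rcons t y)) s
          = last_avg f (rcons s y) *+ N ^ (3 * n).
  by rewrite -mulrnA (mulnC (N ^ 2)%N) subrK.
transitivity (q (rack_orbit_repr y) s *+ N ^ (3 * n)).
  rewrite (Hh _).2 // /phi on_rconsE; congr (_ + _).
  by apply: eq_sdiff => t; rewrite /u on_rconsE.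
congr (_ *+ _); rewrite last_avg_rcons /q.
have [g Gg ->] := rack_orbit_reprE y.
rewrite -[RHS](sum_rsgMl _ Gg); apply: eq_bigr => k _.
by rewrite permM.
Qed.

End SeqCochains.

(** * Transfer to cochains of a fixed degree *)

Section FfunCochains.

Variables (X : finRackType) (A : zmodType).

Local Notation G := (reduced_structure_group X).
Local Notation N := #|G|.

Lemma nth_codom_ord n (x0 : X) (x : {ffun 'I_n -> X}) (i : 'I_n) :
  nth x0 (codom x) i = x i.
Proof. by rewrite (nth_map i) ?size_enum_ord // nth_ord_enum. Qed.

Lemma size_codom_ord n (x : {ffun 'I_n -> X}) : size (codom x) = n.
Proof. by rewrite size_codom card_ord. Qed.

Lemma codom_ffun_inj n : injective (fun x : {ffun 'I_n -> X} => codom x).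
Proof.
move=> x y xy; apply/ffunP=> i.
by rewrite -(nth_codom_ord (x i) x) xy nth_codom_ord.
Qed.

Lemma codom_ffun_ex n (s : seq X) :
  size s = n -> exists x : {ffun 'I_n -> X}, codom x = s.
Proof.
move=> /eqP sn; exists [ffun i => tnth (Tuple sn) i].
rewrite -[RHS](map_tnth_enum (Tuple sn)) codomE.
by apply: eq_map => i; rewrite ffunE.
Qed.

(** Covers both faces at once: [e] is the identity for [face_del] and the action of [x i] for
    [face_act]. *)
Lemma codom_face n (e : X -> X) (i : 'I_n.+1) (x : {ffun 'I_n.+1 -> X}) :
  take i (codom x) ++ map e (drop i.+1 (codom x)) =
  codom [ffun j => if (lift i j < i)%N then x (lift i j) else e (x (lift i j))].
Proof.
have sz : size (take i (codom x)) = i.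
  by rewrite size_takel // size_codom_ord ltnW.
apply: (@eq_from_nth _ (x i)) => [|k].
  rewrite size_cat size_map sz size_drop !size_codom_ord subSS.
  by rewrite subnKC // -ltnS.
rewrite size_cat size_map sz size_drop size_codom_ord subSS.
rewrite subnKC; last by rewrite -ltnS.
move=> kn.
rewrite (nth_codom_ord _ _ (Ordinal kn)) ffunE nth_cat sz /= /bump.
case: (leqP i k) => ik; last first.
  rewrite add0n ik nth_take // -(nth_codom_ord (x i) x (lift _ _)).
  by rewrite /= /bump leqNgt ik.
rewrite add1n ltnNge (leq_trans ik) //= (nth_map (x i)); last first.
  by rewrite size_drop size_codom_ord subSS ltn_sub2r // (leq_ltn_trans ik).
rewrite nth_drop -(nth_codom_ord (x i) x (lift _ _)) /= /bump ik.
by rewrite add1n addSn subnKC.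
Qed.

Lemma rack_diff_codom n (u : seq X -> A) (x : {ffun 'I_n.+1 -> X}) :
  rack_diff [ffun y : {ffun 'I_n -> X} => u (codom y)] x = sdiff u (codom x).
Proof.
rewrite ffunE /sdiff (alt_nth (x ord0)) size_codom_ord big_mkord.
apply: eq_bigr => i _; rewrite nth_codom_ord !ffunE codom_face.
congr ((u _ - u _) *~ _); rewrite -[drop _ _]map_id codom_face.
by apply: eq_codom => j; rewrite !ffunE if_same.
Qed.

Section Degree.

Variable n : nat.
Implicit Types (f : rack_cochain X n A) (x y : {ffun 'I_n -> X}) (s : seq X).

Definition seq_ext f s : A := \sum_(x : {ffun 'I_n -> X} | codom x == s) f x.

Lemma seq_ext_codom f x : seq_ext f (codom x) = f x.
Proof.
rewrite /seq_ext (big_pred1 x) // => y.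
by rewrite /= (inj_eq (@codom_ffun_inj n)).
Qed.

Lemma seq_ext_size f s : size s != n -> seq_ext f s = 0.
Proof.
move=> sn; apply: big_pred0 => x; apply: contraNF sn => /eqP<-.
by rewrite size_codom_ord.
Qed.

Lemma seq_extK f : [ffun x : {ffun 'I_n -> X} => seq_ext f (codom x)] = f.
Proof. by apply/ffunP=> x; rewrite ffunE seq_ext_codom. Qed.

Lemma sdiff_seq_ext f s : is_cocycle f -> sdiff (seq_ext f) s = 0.
Proof.
move=> /eqP df0; have [/codom_ffun_ex[x <-]|sn] := eqVneq (size s) n.+1.
  by rewrite -rack_diff_codom seq_extK df0 ffunE.
apply: alt_eq0 => a y b abs; rewrite !seq_ext_size ?subrr //.
  by apply: contraNneq sn => <-; rewrite -abs !size_cat size_map addnS.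
by apply: contraNneq sn => <-; rewrite -abs !size_cat addnS.
Qed.

Definition orbital f :=
  forall x y, (forall i, rack_orbit (x i) = rack_orbit (y i)) -> f x = f y.

Lemma seq_orbital_ext f : orbital f -> seq_orbital (seq_ext f).
Proof.
move=> f_orb s t st; have /(congr1 size) := st; rewrite !size_map => sz.
have [/codom_ffun_ex[x xs]|sn] := eqVneq (size s) n; last first.
  by rewrite !seq_ext_size -?sz.
have [|y yt] := @codom_ffun_ex n t; first by rewrite -sz -xs size_codom_ord.
rewrite -xs -yt in st *; rewrite !seq_ext_codom; apply: f_orb => i.
have /(congr1 (fun r => nth set0 r i)) := st.
by rewrite !(nth_map (x i)) ?size_codom_ord // !nth_codom_ord.
Qed.

(** The two faces at each index have entrywise equal orbits, so every difference vanishes. *)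
Lemma orbital_cocycle f : orbital f -> is_cocycle f.
Proof.
move=> f_orb; apply/eqP/ffunP=> x; rewrite !ffunE; apply: big1 => i _.
rewrite (f_orb _ (face_act i x)) ?subrr ?mul0rz // => j.
by rewrite !ffunE; case: ifP; rewrite // rack_orbit_op.
Qed.

End Degree.

(** Uniform in the degree: [sdiff] vanishes on the empty sequence, which matches the convention in
    degree 0. *)
Lemma is_coboundaryP n (f : rack_cochain X n A) :
  is_coboundary f <-> exists u, forall x, f x = sdiff u (codom x).
Proof.
case: n f => [|n] f /=; split.
- move=> /eqP->; exists (fun=> 0) => x; rewrite ffunE.
  by rewrite (size0nil (size_codom_ord x)).
- move=> [u fu]; apply/eqP/ffunP=> x; rewrite ffunE fu.
  by rewrite (size0nil (size_codom_ord x)).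
- move=> /asboolP[g ->]; exists (seq_ext g) => x.
  by rewrite -rack_diff_codom seq_extK.
move=> [u fu]; apply/asboolP; exists [ffun y : {ffun 'I_n -> X} => u (codom y)].
by apply/ffunP=> x; rewrite fu rack_diff_codom.
Qed.

Lemma orbital_coboundary_eq0 n (f : rack_cochain X n A) :
  orbital f -> is_coboundary f -> f *+ N ^ n = 0.
Proof.
move=> f_orb /is_coboundaryP[u fu]; apply/ffunP=> x; rewrite ffunMnE ffunE.
rewrite -seq_ext_codom; apply: (orbital_coboundary (seq_orbital_ext f_orb)) _.
  by move=> s /codom_ffun_ex[y <-]; rewrite seq_ext_codom.
exact: size_codom_ord.
Qed.

Definition orbital_class n (f : rack_cochain X n A) (f_orb : orbital f) :
    rack_cohomology X n A :=
  coh_class (RackCocycle (orbital_cocycle f_orb)).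

Lemma cohomology_orbital n (c : rack_cohomology X n A) :
  exists phi (phi_orb : orbital phi), c *+ N ^ (3 * n) = orbital_class phi_orb.
Proof.
rewrite -[c]coh_reprK; set z := coh_repr c.
have dz0 := sdiff_seq_ext _ (cocycle_valP z).
have [phi phi_orb [u zu]] := cocycle_orbital n dz0.
have psi_orb : orbital [ffun x : {ffun 'I_n -> X} => phi (codom x)].
  move=> x y xy; rewrite !ffunE; apply: phi_orb; rewrite !codomE -!map_comp.
  by apply: eq_map => i /=.
exists _, psi_orb; apply/eqP.
rewrite /orbital_class -raddfMn -subr_eq0 -raddfB coh_class_eq0 raddfB raddfMn.
apply/is_coboundaryP; exists u => x; rewrite /= !ffunE ffunMnE -seq_ext_codom.
by rewrite zu ?size_codom_ord // addrC addKr.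
Qed.

End FfunCochains.

(** * Torsion of the integral cohomology *)

Lemma ffun_mulrn_eq0 (I : finType) (R : numDomainType) (f : {ffun I -> R}) k :
  f *+ k = 0 -> (0 < k)%N -> f = 0.
Proof.
move=> fk k_gt0; apply/ffunP=> i; have /ffunP/(_ i)/eqP := fk.
by rewrite ffunMnE !ffunE mulrn_eq0 gtn_eqF // => /eqP.
Qed.

(** Let an orbital phi represent N^(3n) v. Then p phi is an orbital coboundary, so a power of N
    annihilates it, and phi = 0 because the integers are torsion free. Thus both p and N^(3n) kill
    v, and Bezout gives v = 0 unless p divides N. *)
Lemma rack_cohomology_torsion_prime (X : finRackType) n p :
  torsion_prime (rack_cohomology X n int) p ->
  (p %| #|reduced_structure_group X|)%N.
Proof.
set N := #|_| => -[p_pr [v v_neq0 vp]].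
have N_gt0 : (0 < N)%N by apply: cardG_gt0.
have [phi [phi_orb vphi]] := cohomology_orbital v.
have phi0 : phi = 0.
  apply: (@ffun_mulrn_eq0 _ _ _ p); last exact: prime_gt0.
  apply: (@ffun_mulrn_eq0 _ _ _ (N ^ n)); last by rewrite expn_gt0 N_gt0.
  apply: orbital_coboundary_eq0.
    by move=> x y xy; rewrite !ffunMnE (phi_orb x y).
  rewrite -[phi]/(val (RackCocycle (orbital_cocycle phi_orb))) -raddfMn.
  by rewrite -coh_class_eq0 raddfMn -[X in X *+ p]vphi mulrnAC vp mul0rn.
have vN : v *+ N ^ (3 * n) = 0.
  apply/eqP; rewrite vphi coh_class_eq0 /= phi0.
  by have [] := is_coboundary_zmod X n int.
apply: contraNT v_neq0; rewrite -prime_coprime // => pN.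
have /eqP copr : coprime p (N ^ (3 * n)) by apply: coprimeXr.
have [a b abE _] := egcdnP (N ^ (3 * n)) (prime_gt0 p_pr).
have := congr1 (GRing.natmul v) abE.
rewrite copr mulrnDr mulr1n !(mulnC _ p, mulnC _ (N ^ _)%N) !mulrnA vp vN.
by rewrite !mul0rn add0r => <-.
Qed.

(** * Dimension of the rational cohomology *)

Section RationalCohomology.

Variables (X : finRackType) (n : nat).

Local Notation N := #|reduced_structure_group X|.
Local Notation O := {o : {set X} | o \in rack_orbits X}.
Local Notation V := {ffun {ffun 'I_n -> O} -> rat^o}.

Lemma rack_orbit_in (x : X) : rack_orbit x \in rack_orbits X.
Proof. exact: imset_f. Qed.

Definition orbit_of (x : X) : O := exist _ (rack_orbit x) (rack_orbit_in x).

Lemma orbit_of_surj (o : O) : exists x, orbit_of x = o.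
Proof.
have /imsetP[x _ ox] := valP o.
by exists x; apply: val_inj; rewrite ox.
Qed.

Definition orbit_cochain (psi : V) : rack_cochain X n rat^o :=
  [ffun x : {ffun 'I_n -> X} => psi [ffun i => orbit_of (x i)]].

Lemma orbit_cochain_orbital psi : orbital (orbit_cochain psi).
Proof.
move=> x y xy; rewrite !ffunE; congr (psi _); apply/ffunP=> i.
by rewrite !ffunE; apply: val_inj; apply: xy.
Qed.

Lemma orbitalP (f : rack_cochain X n rat^o) :
  orbital f -> exists psi, f = orbit_cochain psi.
Proof.
move=> f_orb; have /choice[r rK] := orbit_of_surj.
exists [ffun o : {ffun 'I_n -> O} => f [ffun i => r (o i)]].
apply/ffunP=> x; rewrite !ffunE.
by apply: f_orb => i; rewrite !ffunE -[rack_orbit (r _)]/(val (orbit_of _)) rK.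
Qed.

Definition orbit_class (psi : V) : rack_cohomology X n rat^o :=
  orbital_class (orbit_cochain_orbital psi).

Lemma orbit_class_linear : linear orbit_class.
Proof.
move=> a psi1 psi2; rewrite /orbit_class /orbital_class -linearP.
congr coh_class.
by apply: val_inj; apply/ffunP=> x; rewrite /= !ffunE.
Qed.

HB.instance Definition _ :=
  GRing.isLinear.Build _ _ _ _ orbit_class orbit_class_linear.

(** A power of [N] annihilates the pulled back cochain, which is therefore zero over the rationals;
    pullback along a surjection is injective. *)
Lemma orbit_class_inj psi : orbit_class psi = 0 -> psi = 0.
Proof.
move/eqP; rewrite coh_class_eq0 => /= cob.
have f0 : orbit_cochain psi = 0.
  apply: (@ffun_mulrn_eq0 _ rat _ (N ^ n)); last by rewrite expn_gt0 cardG_gt0.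
  exact: orbital_coboundary_eq0 (orbit_cochain_orbital psi) cob.
apply/ffunP=> o; have /choice[r rK] := orbit_of_surj.
have /ffunP/(_ [ffun i => r (o i)]) := f0; rewrite !ffunE => <-.
by congr (psi _); apply/ffunP=> i; rewrite !ffunE rK.
Qed.

(** Over the rationals the power of [N] left by averaging can be divided out. *)
Lemma orbit_class_surj c : exists psi, orbit_class psi = c.
Proof.
have [phi [phi_orb]] := cohomology_orbital c; set k := (N ^ _)%N.
have [psi phiE] := orbitalP phi_orb.
have k_neq0 : k%:R != 0 :> rat by rewrite pnatr_eq0 -lt0n expn_gt0 cardG_gt0.
move=> cE; exists (k%:R^-1 *: psi); rewrite linearZ /=.
apply: (canLR (scalerK k_neq0)); rewrite scaler_nat cE.
by congr coh_class; apply: val_inj; rewrite /= phiE.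
Qed.

Lemma dim_rational_rack_cohomology :
  \dim {: rack_cohomology X n rat^o} = (#|rack_orbits X| ^ n)%N.
Proof.
have ker0 : lker (linfun orbit_class) = 0%VS.
  apply/eqP; rewrite -subv0; apply/subvP=> psi; rewrite memv_ker lfunE memv0.
  by move=> /eqP/orbit_class_inj/eqP.
have <- : limg (linfun orbit_class) = fullv.
  apply/vspaceP=> c; rewrite memvf; have [psi <-] := orbit_class_surj c.
  by rewrite -[orbit_class _]lfunE memv_img ?memvf.
rewrite limg_dim_eq ?ker0 ?capv0 // dimvf.
rewrite /dim /= card_ffun card_ord card_sig muln1.
by congr (_ ^ _)%N; apply: eq_card => o.
Qed.

End RationalCohomology.

Theorem corollary4p3 (X : finRackType) :
  (forall i : nat,
     \dim {: rack_cohomology X i rat^o} = (#|rack_orbits X| ^ i)%N) /\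
  (forall (i p : nat),
     torsion_prime (rack_cohomology X i int) p ->
     (p %| #|reduced_structure_group X|)%N).
Proof.
split=> [i|i p]; first exact: dim_rational_rack_cohomology.
exact: rack_cohomology_torsion_prime.
Qed.
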